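(* Let $R$ be a finite commutative ring, $V$ a finite $R$-module, $P$ a probability on $V$ that is constant on associates and $Q$ a probability on $R$. Consider triples $(e,\mathcal O,\rho)$ where \begin{enumerate} \item $e\in E(R)$; \item $\mathcal O=U(R)\chi$ is an orbit of $U(R)$ on $e\widehat V\setminus\bigcup_{f\in E(R),\ Rf\subsetneq Re}f\widehat V$; \item $\rho\in\widehat{U(Re)}$ with $\mathrm{St}_{U(Re)}(\chi)\subseteq\ker\rho$. \end{enumerate} Put $\widehat P(\chi)=\sum_{b\in V}P(b)\chi(b)$ and $\widehat Q(\rho)=\sum_{a\in R,\ Ra\supseteq Re}Q(a)\rho(ae)$. Then the eigenvalues, counted with multiplicity, of the transition matrix of the coin-toss walk on $V$ with heads probability $\alpha$ are exactly the numbers $\alpha\widehat P(\chi)+(1-\alpha)\widehat Q(\rho)$, and those of the affine walk on $V$ are exactly the numbers $\widehat P(\chi)\widehat Q(\rho)$ (with $\chi\in\mathcal O$), as $(e,\mathcal O,\rho)$ ranges over all such triples, each triple contributing one eigenvalue of multiplicity one.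
   Context: $E(R)$: idempotents of $R$; $U(S)$: unit group of a ring $S$; $\widehat{U(Re)}$: characters of the abelian group $U(Re)$ ($Re$ is a unital ring with identity $e$; if $Ra\supseteq Re$ then $ae\in U(Re)$). $\widehat V$ is the group of characters of $(V,+)$, an $R$-module via $(r\chi)(v)=\chi(rv)$; $f\widehat V=\{f\chi:\chi\in\widehat V\}$. $\mathrm{St}_{U(Re)}(\chi)=\{u\in U(Re):u\chi=\chi\}$. $v_1,v_2\in V$ are associates if $v_1=uv_2$ for some $u\in U(R)$; $P$ constant on associates means $P(uv)=P(v)$. The transition matrix has $(x,y)$-entry the probability of moving from $x$ to $y$. Coin-toss walk with heads probability $\alpha\in[0,1]$: from $x$, with probability $\alpha$ move to $x+b$ ($b$ chosen by $P$), with probability $1-\alpha$ move to $ax$ ($a$ chosen by $Q$). Affine walk: choose independently $a$ by $Q$ and $b$ by $P$, move from $x$ to $ax+b$. *)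

(* Defs.v *)
From HB Require Import structures.
From mathcomp Require Import all_boot all_order all_algebra.
From mathcomp Require Import finmap complex reals.

Set Implicit Arguments.
Unset Strict Implicit.
Unset Printing Implicit Defensive.

Import Order.TTheory GRing.Theory Num.Theory.
Local Open Scope ring_scope.
Local Open Scope complex_scope.

Section Ring.
Variable R : finComNzRingType.

Definition idempotents : {set R} := [set e | e * e == e].

Definition units : {set R} := [set u | [exists v, u * v == 1]].

(* The ideal Ra; for an idempotent e, Re is also a ring with identity e. *)
Definition principal (a : R) : {set R} := [set r * a | r : R].

(* U(Re); the inverse is relative to e, so for e = 0 this is {0}. *)
Definition units_at (e : R) : {set R} :=
  [set u in principal e | [exists v in principal e, u * v == e]].

End Ring.

Section Probability.
Variables (K : realType) (T : finType).

Definition is_probability (P : T -> K) : Prop :=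
  (forall x, 0 <= P x) /\ \sum_x P x = 1.

Definition transition_mx (p : T -> T -> K) : 'M[K[i]]_#|T| :=
  \matrix_(i, j) (p (enum_val i) (enum_val j))%:C.

End Probability.

(* The list s consists of the eigenvalues of M, repeated according to their
   (algebraic) multiplicity. *)
Definition eigenvalues_are (C : fieldType) n (M : 'M[C]_n) (s : seq C) : Prop :=
  char_poly M = \prod_(z <- s) ('X - z%:P).

Section Walks.
Variables (K : realType) (R : finComNzRingType) (V : finLmodType R).
Variables (P : V -> K) (Q : R -> K).

Definition constant_on_associates : Prop :=
  forall u v, u \in units R -> P (u *: v) = P v.

Definition coin_toss_walk (alpha : K) (x y : V) : K :=
  alpha * (\sum_(b : V | x + b == y) P b)
  + (1 - alpha) * (\sum_(a : R | a *: x == y) Q a).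

Definition affine_walk (x y : V) : K :=
  \sum_(a : R) \sum_(b : V | a *: x + b == y) Q a * P b.

End Walks.

Section Characters.
Variables (K : realType) (R : finComNzRingType) (V : finLmodType R).

Definition is_character (chi : {ffun V -> K[i]}) : Prop :=
  chi 0 = 1 /\ forall v w, chi (v + w) = chi v * chi w.

Definition char_scale (r : R) (chi : {ffun V -> K[i]}) : {ffun V -> K[i]} :=
  [ffun v => chi (r *: v)].

Definition in_scaled_dual (f : R) (chi : {ffun V -> K[i]}) : Prop :=
  exists2 psi, is_character psi & chi = char_scale f psi.

(* e V^ minus the union of the f V^ over idempotents f with Rf properly
   contained in Re. *)
Definition in_stratum (e : R) (chi : {ffun V -> K[i]}) : Prop :=
  in_scaled_dual e chi /\
  forall f, f \in idempotents R -> principal f \proper principal e ->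
    ~ in_scaled_dual f chi.

Definition char_orbit (chi : {ffun V -> K[i]}) : {fset {ffun V -> K[i]}} :=
  [fset char_scale u chi | u in units R]%fset.

Definition stabilizer (e : R) (chi : {ffun V -> K[i]}) : {set R} :=
  [set u in units_at e | char_scale u chi == chi].

(* A character of U(Re) is encoded by its extension by 0 to all of R, so that
   equality of functions on R is equality of characters. *)
Definition is_unit_character (e : R) (rho : {ffun R -> K[i]}) : Prop :=
  [/\ rho e = 1,
      {in units_at e &, forall u v, rho (u * v) = rho u * rho v} &
      forall u, u \notin units_at e -> rho u = 0].

Definition unit_ker (e : R) (rho : {ffun R -> K[i]}) : {set R} :=
  [set u in units_at e | rho u == 1].

Definition triple : Type :=
  (R * {fset {ffun V -> K[i]}} * {ffun R -> K[i]})%type.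

HB.instance Definition _ := Choice.on triple.

Definition idem_of (t : triple) : R := t.1.1.
Definition orbit_of (t : triple) : {fset {ffun V -> K[i]}} := t.1.2.
Definition char_of (t : triple) : {ffun R -> K[i]} := t.2.

Definition admissible (t : triple) : Prop :=
  idem_of t \in idempotents R /\
  exists chi : {ffun V -> K[i]},
    [/\ in_stratum (idem_of t) chi, orbit_of t = char_orbit chi,
        is_unit_character (idem_of t) (char_of t) &
        stabilizer (idem_of t) chi \subset unit_ker (idem_of t) (char_of t)].

Definition hatP (P : V -> K) (chi : {ffun V -> K[i]}) : K[i] :=
  \sum_(b : V) (P b)%:C * chi b.

Definition hatQ (Q : R -> K) (e : R) (rho : {ffun R -> K[i]}) : K[i] :=
  \sum_(a : R | principal e \subset principal a) (Q a)%:C * rho (a * e).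

End Characters.

(* Main.v *)
(* The characters of V form a basis of the functions on V, and in it both walks
   send chi to a combination of chi and of the translates a.chi.  If Ra contains
   Re, where e is the least idempotent fixing chi, then a.chi lies in the unit
   orbit of chi; otherwise the submodule R(a.chi) is strictly smaller than R.chi.
   So the walk is block triangular for the size of R.chi, with one diagonal block
   for each unit orbit.  Each block belongs to the algebra of the abelian group
   U(Re) acting transitively on the orbit, and is diagonalized by the characters
   of U(Re) that are trivial on the stabilizer. *)
Require Import Defs.
From HB Require Import structures.
From mathcomp Require Import all_boot all_order all_fingroup all_algebra.
From mathcomp Require Import separable cyclotomic.
From mathcomp Require Import finmap complex reals.
From mathcomp Require Import ring.

Set Implicit Arguments.
Unset Strict Implicit.
Unset Printing Implicit Defensive.

Import Order.TTheory GRing.Theory Num.Theory.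
Local Open Scope ring_scope.
Local Open Scope complex_scope.

(** * Simultaneous diagonalization and triangular characteristic polynomials *)

Section LinearAlgebra.
Variable C : numClosedFieldType.

Lemma perm_mxX n (s : 'S_n.+1) m :
  (perm_mx s : 'M[C]_n.+1) ^+ m = perm_mx (s ^+ m)%g.
Proof.
elim: m => [|m IHm]; first by rewrite expr0 expg0 perm_mx1.
by rewrite exprS expgS perm_mxM IHm.
Qed.

(** The matrix is a root of ['X^m - 1], with [m] the order of [s], and this polynomial is separable
    in characteristic 0. *)
Lemma diagonalizable_perm_mx n (s : 'S_n) :
  diagonalizable (perm_mx s : 'M[C]_n).
Proof.
case: n s => [|n] s.
  by rewrite [perm_mx s]flatmx0 -(flatmx0 0); apply: diagonalizable0.
apply/diagonalizableP; set m := #[s]%g.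
have m_gt0 : (0 < m)%N by apply: order_gt0.
have [rs Drs] := closed_field_poly_normal ('X^m - 1 : {poly C}).
have mon : ('X^m - 1 : {poly C}) \is monic by rewrite monicXnsubC.
rewrite (monicP mon) scale1r in Drs; exists rs.
  rewrite -separable_prod_XsubC -Drs; apply: separable_Xn_sub_1.
  by rewrite pnatr_eq0 -lt0n.
rewrite -Drs; apply: mxminpoly_min.
by rewrite rmorphB rmorphXn rmorph1 /= horner_mx_X perm_mxX expg_order
  perm_mx1 subrr.
Qed.

(** On row vectors this is pushforward along [f], which need not be injective: non-units of the ring
    act this way too. *)
Definition fun_mx n (f : 'I_n -> 'I_n) : 'M[C]_n :=
  \matrix_(i, j) (f i == j)%:R.

Lemma mul_fun_mx n (f g : 'I_n -> 'I_n) :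
  fun_mx f *m fun_mx g = fun_mx (g \o f).
Proof.
apply/matrixP => i j; rewrite !mxE (bigD1 (f i)) //= !mxE eqxx mul1r.
by rewrite big1 ?addr0 // => k /negPf ki; rewrite mxE eq_sym ki mul0r.
Qed.

Lemma mulmx_fun_mxE m n (A : 'M[C]_(m, n)) (f : 'I_n -> 'I_n) k j :
  (A *m fun_mx f) k j = \sum_(i | f i == j) A k i.
Proof.
rewrite mxE [RHS]big_mkcond; apply: eq_bigr => i _.
by rewrite mxE; case: eqP; rewrite ?mulr1 ?mulr0.
Qed.

Lemma mulmx_fun_mx_inj m n (A : 'M[C]_(m, n)) (f : 'I_n -> 'I_n) k i :
  injective f -> (A *m fun_mx f) k (f i) = A k i.
Proof.
move=> injf; rewrite mulmx_fun_mxE (bigD1 i) //= big1 ?addr0 // => j.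
by case/andP=> /eqP/injf-> /eqP.
Qed.

Lemma diagonalizable_fun_mx n (f : 'I_n -> 'I_n) :
  injective f -> diagonalizable (fun_mx f).
Proof.
move=> injf; have -> : fun_mx f = perm_mx (perm injf).
  by apply/matrixP => i j; rewrite !mxE permE.
exact: diagonalizable_perm_mx.
Qed.

Lemma codiagonalize (T : eqType) (s : seq T) n (A : T -> 'M[C]_n) :
    {in s &, forall t u, comm_mx (A t) (A u)} ->
    {in s, forall t, diagonalizable (A t)} ->
  exists2 B : 'M[C]_n, B \in unitmx &
  exists mu : T -> 'rV[C]_n, {in s, forall t, B *m A t = diag_mx (mu t) *m B}.
Proof.
move=> cA dA; have [B uB /allP BA] : codiagonalizable (map A s).
  apply/codiagonalizableP; split=> [_ _ /mapP[t ts ->] /mapP[u us ->]|].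
    exact: cA.
  by move=> _ /mapP[t ts ->]; apply: dA.
exists B => //; exists (fun t => \row_k (B *m A t *m invmx B) k k) => t ts.
have /(diagonalizable_forP _ uB) D := BA _ (map_f A ts).
apply: (can_inj (mulmxK (_ : invmx B \in unitmx))); first by rewrite unitmx_inv.
rewrite mulmxK //; apply/matrixP => i j; rewrite [RHS]mxE [in RHS]mxE.
by have [->|ij] := eqVneq i j; [rewrite mulr1n | rewrite mulr0n D].
Qed.

(** Expand [w] in the eigenbasis: a single nonzero coordinate [k] identifies all the eigenvalues at
    once. Used to show that every expected joint eigenvalue system does occur. *)
Lemma codiagonal_eigenvector (T : eqType) (s : seq T) n (A : T -> 'M[C]_n)
    (B : 'M[C]_n) (mu : T -> 'rV[C]_n) (nu : T -> C) (w : 'rV[C]_n) :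
    B \in unitmx -> {in s, forall t, B *m A t = diag_mx (mu t) *m B} ->
    w != 0 -> {in s, forall t, w *m A t = nu t *: w} ->
  exists k, {in s, forall t, mu t 0 k = nu t}.
Proof.
move=> uB BA w0 wA; pose x := w *m invmx B.
have wE : w = x *m B by rewrite mulmxKV.
have /rV0Pn[k xk] : x != 0 by apply: contraNneq w0 => x0; rewrite wE x0 mul0mx.
exists k => t ts; have := wA t ts.
rewrite wE -mulmxA BA // mulmxA scalemxAl => /(can_inj (mulmxK uB)).
by move/rowP/(_ k); rewrite mul_mx_diag [LHS]mxE [RHS]mxE mulrC; apply: mulIf.
Qed.

Lemma unitmx_row_neq0 n (B : 'M[C]_n) k :
  B \in unitmx -> exists i, B k i != 0.
Proof.
move=> uB; apply/existsP; rewrite -[X in is_true X]negbK negb_exists.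
apply: contraL uB => /forallP B0; rewrite unitmxE unitfE (expand_det_row _ k).
by rewrite big1 ?eqxx // => i _; move: (B0 i); rewrite negbK => /eqP->; rewrite mul0r.
Qed.

(* In the Leibniz expansion, a permutation with a nonzero term cannot increase
   the height, hence preserves it, hence fixes every index. *)
Lemma det_height_trig (F : comNzRingType) n (A : 'M[F]_n) (h : 'I_n -> nat) :
    (forall i j, A i j != 0 -> i != j -> (h j < h i)%N) ->
  \det A = \prod_i A i i.
Proof.
move=> Ah; rewrite /determinant (bigD1 1%g) //= odd_perm1 expr0 mul1r.
rewrite [X in _ + X]big1 => [|s s1].
  by rewrite addr0; apply: eq_bigr => i _; rewrite perm1.
suff [i /eqP Ai0] : exists i, A i (s i) == 0.
  by rewrite (bigD1 i) //= Ai0 mul0r mulr0.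
apply/existsP; rewrite -[X in is_true X]negbK negb_exists.
apply: contra s1 => /forallP nz.
have le i : (h (s i) <= h i)%N.
  by have [<- //|ne] := eqVneq i (s i); apply/ltnW/Ah.
have: (\sum_i h (s i) = \sum_i h i)%N by rewrite [RHS](reindex_inj (@perm_inj _ s)).
move=> eq_sum; apply/eqP/permP => i; rewrite perm1; apply/eqP.
apply: contraTT isT => ne; have lt : (h (s i) < h i)%N by apply: Ah; rewrite // eq_sym.
suff : (\sum_i h (s i) < \sum_i h i)%N by rewrite eq_sum ltnn.
by rewrite (bigD1 i) //= [ltnRHS](bigD1 i) //= -addSn leq_add // leq_sum.
Qed.

Lemma char_poly_mul_eq (F : fieldType) n (B M D : 'M[F]_n) :
  B \in unitmx -> B *m M = D *m B -> char_poly M = char_poly D.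
Proof.
move=> uB BM; pose PB := map_mx polyC B.
have E : PB *m char_poly_mx M = char_poly_mx D *m PB.
  rewrite /char_poly_mx mulmxBr mulmxBl -!map_mxM BM.
  by rewrite scalar_mxC.
have dB : \det PB != 0.
  by rewrite det_map_mx polyC_eq0 -unitfE -unitmxE.
by apply: (mulfI dB); rewrite -det_mulmx E det_mulmx mulrC.
Qed.

Lemma char_poly_trmx (F : comNzRingType) n (M : 'M[F]_n) :
  char_poly M^T = char_poly M.
Proof.
rewrite /char_poly -[RHS]det_tr; congr (\det _).
by rewrite /char_poly_mx linearB /= tr_scalar_mx map_trmx.
Qed.

Lemma char_poly_height_trig (F : fieldType) n (A : 'M[F]_n) (h : 'I_n -> nat) :
    (forall i j, A i j != 0 -> i != j -> (h j < h i)%N) ->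
  char_poly A = \prod_i ('X - (A i i)%:P).
Proof.
move=> Ah; rewrite /char_poly (det_height_trig (h := h)) => [|i j].
  by apply: eq_bigr => i _; rewrite !mxE eqxx.
rewrite !mxE => + ij; rewrite (negPf ij) sub0r oppr_eq0 polyC_eq0.
by move/Ah; apply.
Qed.

End LinearAlgebra.

(** * Idempotents and units of a finite commutative ring *)

Section FiniteRing.
Variable R : finComNzRingType.
Implicit Types a b e f r u v : R.

Lemma unitsP u : reflect (exists v, u * v = 1) (u \in units R).
Proof. by rewrite inE; apply: (iffP existsP) => -[v /eqP ?]; exists v => //; apply/eqP. Qed.

Lemma units1 : 1 \in units R.
Proof. by apply/unitsP; exists 1; rewrite mulr1. Qed.

Lemma unitsM u v : u \in units R -> v \in units R -> u * v \in units R.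
Proof.
move=> /unitsP[u' uu'] /unitsP[v' vv']; apply/unitsP; exists (u' * v').
by rewrite mulrACA uu' vv' mulr1.
Qed.

Lemma idempotentsP e : reflect (e * e = e) (e \in idempotents R).
Proof. by rewrite inE; apply: eqP. Qed.

Lemma principalP a b : reflect (exists r, b = r * a) (b \in principal a).
Proof. by apply: (iffP imsetP) => [[r _ ->]|[r ->]]; exists r. Qed.

Lemma principal_idem e a :
  e \in idempotents R -> (a \in principal e) = (a * e == a).
Proof.
move/idempotentsP => ee; apply/principalP/eqP => [[r ->]|<-].
  by rewrite -mulrA ee.
by exists a.
Qed.

Lemma principal_subset a b : (principal a \subset principal b) = (a \in principal b).
Proof.
apply/subsetP/idP => [-> //|/principalP[r ->] _ /principalP[s ->]].
  by apply/principalP; exists 1; rewrite mul1r.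
by apply/principalP; exists (s * r); rewrite mulrA.
Qed.

(** The inverse may be sought in all of [R]: multiplying it by [e] moves it into [Re] and keeps the
    product equal to [e]. *)
Lemma units_atP e u : e \in idempotents R ->
  reflect (u * e = u /\ exists v, u * v = e) (u \in units_at e).
Proof.
move=> eE; rewrite inE principal_idem //; apply: (iffP andP) => -[].
  by move/eqP => ue /existsP[v /andP[_ /eqP uv]]; split=> //; exists v.
move=> ue [v uv]; split; first exact/eqP.
apply/existsP; exists (v * e); rewrite principal_idem // -mulrA.
by rewrite (idempotentsP _ eE) eqxx mulrA uv (idempotentsP _ eE) eqxx.
Qed.

Lemma units_at_id e : e \in idempotents R -> e \in units_at e.
Proof.
by move=> eE; apply/(units_atP _ eE); rewrite (idempotentsP _ eE); split=> //;
  exists e; apply/idempotentsP.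
Qed.

(* The section U(Re) -> U(R) of multiplication by [e]. *)
Definition extend_unit e u := u + (1 - e).

Lemma extend_unit_mul e u : e \in idempotents R -> u * e = u ->
  extend_unit e u * e = u.
Proof.
by move=> /idempotentsP ee ue; rewrite mulrDl ue mulrBl mul1r ee subrr addr0.
Qed.

Lemma extend_unitM e u v : e \in idempotents R -> u * e = u -> v * e = v ->
  extend_unit e (u * v) = extend_unit e u * extend_unit e v.
Proof.
move=> /idempotentsP ee ue ve; rewrite /extend_unit mulrDl (mulrDr u) (mulrDr (1 - e)).
have uK w : w * e = w -> w * (1 - e) = 0 by move=> we; rewrite mulrBr mulr1 we subrr.
rewrite (uK u) // addr0 [(1 - e) * v]mulrC (uK v) // add0r mulrBl mul1r.
by rewrite (uK e) // subr0.
Qed.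

Lemma extend_unit_units e u : e \in idempotents R -> u \in units_at e ->
  extend_unit e u \in units R.
Proof.
move=> eE /(units_atP _ eE)[ue [v uv]]; apply/unitsP.
have ee := idempotentsP _ eE.
exists (extend_unit e (v * e)); rewrite -extend_unitM //.
  by rewrite mulrA uv ee /extend_unit addrC subrK.
by rewrite -mulrA ee.
Qed.

Lemma units_at_mulr e u : e \in idempotents R -> u \in units R ->
  u * e \in units_at e.
Proof.
move=> eE /unitsP[v uv]; have ee := idempotentsP _ eE.
apply/(units_atP _ eE); rewrite -mulrA ee; split=> //; exists v.
by rewrite mulrAC uv mul1r.
Qed.

(** If [e = r * a], then [r] inverts [a * e] relative to [e]. Hence [hatQ] evaluates [rho] only at
    units of [Re]. *)
Lemma units_at_principal e a : e \in idempotents R ->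
  principal e \subset principal a -> a * e \in units_at e.
Proof.
move=> eE; rewrite principal_subset => /principalP[r er].
have ee := idempotentsP _ eE.
apply/(units_atP _ eE); rewrite -mulrA ee; split=> //; exists r.
by rewrite mulrAC [a * r]mulrC -er.
Qed.

(** By pigeonhole the powers of [b] are periodic from some exponent [p] on, with period [q]. *)
Lemma idempotent_power b : exists2 m, (0 < m)%N & b ^+ m \in idempotents R.
Proof.
have [p [q q0 pq]] : exists p, exists2 q, (0 < q)%N & b ^+ (p + q) = b ^+ p.
  pose g (i : 'I_#|R|.+1) := b ^+ i.
  have /injectivePn[i [j ij gij]] : ~~ injectiveb g.
    apply/negP => /injectiveP/leq_card; rewrite card_ord.
    by rewrite ltnn.
  wlog lij : i j ij gij / (i < j)%N => [W|].
    have [/W|/W|/val_inj/eqP] := ltngtP i j; [by apply| | by rewrite (negPf ij)].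
    by apply; rewrite 1?eq_sym.
  by exists i, (j - i)%N; rewrite ?subn_gt0 // subnKC 1?ltnW.
have perq t : b ^+ (p + t * q) = b ^+ p.
  elim: t => [|t IHt]; first by rewrite addn0.
  by rewrite mulSn addnA exprD pq -exprD.
(* A multiple of the period that is at least [p]; the successor keeps it positive when [p = 0]. *)
exists (p.+1 * q)%N; first by rewrite muln_gt0.
have le : (p <= p.+1 * q)%N by apply: leq_trans (leq_pmulr _ q0).
apply/idempotentsP; rewrite -exprD -{1}(subnKC le) addnAC exprD perq -exprD.
by rewrite subnKC.
Qed.

End FiniteRing.

(** * Actions of the multiplicative monoid of [R] on a finite set *)

Section MonoidAction.
Variables (C : numClosedFieldType) (R : finComNzRingType) (n : nat).
Variable act : R -> 'I_n -> 'I_n.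
Hypothesis act1 : forall i, act 1 i = i.
Hypothesis actM : forall a b i, act (a * b) i = act a (act b i).

Definition unit_orbit (i : 'I_n) : {set 'I_n} := [set act u i | u in units R].

(** A product of idempotents lies below each of its factors, so this is the minimum of the
    idempotents fixing [i]. *)
Definition least_idem (i : 'I_n) : R :=
  \prod_(f in idempotents R | act f i == i) f.

Definition height (i : 'I_n) : nat := #|[set act r i | r : R]|.

Lemma unit_orbit_refl i : i \in unit_orbit i.
Proof. by apply/imsetP; exists 1; rewrite ?units1 ?act1. Qed.

Lemma unit_orbit_act u i : u \in units R -> unit_orbit (act u i) = unit_orbit i.
Proof.
move=> uU; have /unitsP[v uv] := uU.
have vU : v \in units R by apply/unitsP; exists u; rewrite mulrC.
apply/setP => j; apply/imsetP/imsetP => -[w wU ->].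
  by exists (w * u); rewrite ?unitsM // actM.
by exists (w * v); rewrite ?unitsM // -actM -mulrA [v * u]mulrC uv mulr1.
Qed.

Lemma unit_orbit_eqP i j :
  unit_orbit j = unit_orbit i -> exists2 u, u \in units R & j = act u i.
Proof. by move=> E; apply/imsetP; rewrite -/(unit_orbit i) -E unit_orbit_refl. Qed.

Lemma act_inj u : u \in units R -> injective (act u).
Proof.
case/unitsP=> v uv i j E.
by rewrite -(act1 i) -(act1 j) -uv [u * v]mulrC !actM E.
Qed.

Lemma height_orbit i j : unit_orbit j = unit_orbit i -> height j = height i.
Proof.
case/unit_orbit_eqP=> u /unitsP[v uv] ->; congr #|pred_of_set _|.
apply/setP => k; apply/imsetP/imsetP => -[r _ ->].
  by exists (r * u); rewrite ?actM.
by exists (r * v) => //; rewrite -actM -mulrA [v * u]mulrC uv mulr1.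
Qed.

Lemma least_idem_idem i : least_idem i \in idempotents R.
Proof.
apply/idempotentsP; rewrite /least_idem -big_split /=; apply: eq_bigr => f.
by case/andP=> /idempotentsP.
Qed.

Lemma act_least_idem i : act (least_idem i) i = i.
Proof.
apply: (big_ind (fun e => act e i = i)) => // [a b ai bi|f /andP[_ /eqP //]].
by rewrite actM bi.
Qed.

Lemma least_idem_min i f :
  f \in idempotents R -> act f i = i -> least_idem i * f = least_idem i.
Proof.
move=> fE fi; rewrite /least_idem (bigD1 f) /=; last by rewrite fE fi eqxx.
by rewrite mulrAC (idempotentsP _ fE).
Qed.

(** By commutativity and injectivity of the action of a unit, [i] and its unit translates are fixed
    by the same idempotents. *)
Lemma least_idem_orbit i j :
  unit_orbit j = unit_orbit i -> least_idem j = least_idem i.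
Proof.
case/unit_orbit_eqP=> u uU ->; apply: eq_bigl => f; congr (_ && _).
by rewrite -actM mulrC actM (inj_eq (act_inj uU)).
Qed.

Lemma act_mul_least i a : act (a * least_idem i) i = act a i.
Proof. by rewrite actM act_least_idem. Qed.

(** When [a * least_idem i] is a unit of [Re], this trades [a] for a unit of [R] with the same
    effect on [i]. *)
Lemma act_extend_unit i a :
  act (extend_unit (least_idem i) (a * least_idem i)) i = act a i.
Proof.
rewrite -act_mul_least extend_unit_mul ?least_idem_idem ?act_mul_least //.
by rewrite -mulrA (idempotentsP _ (least_idem_idem i)).
Qed.

(* If [a] does not lower the height of [i], some [r * a] fixes [i], and then so
   does an idempotent power of [r * a]. *)
Lemma height_act_lt i a :
  ~~ (principal (least_idem i) \subset principal a) ->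
  (height (act a i) < height i)%N.
Proof.
apply: contraR; rewrite -leqNgt => le.
have sub : [set act r (act a i) | r : R] \subset [set act r i | r : R].
  apply/subsetP => _ /imsetP[r _ ->]; apply/imsetP; exists (r * a) => //.
have /eqP E : [set act r (act a i) | r : R] == [set act r i | r : R].
  by rewrite eqEcard sub.
have : i \in [set act r (act a i) | r : R].
  by rewrite E; apply/imsetP; exists 1; rewrite ?act1.
case/imsetP=> r _; rewrite -actM => ri.
have [[//|m] _ mE] := idempotent_power (r * a).
have fix_m : act ((r * a) ^+ m.+1) i = i.
  by elim: m.+1 => [|k IHk]; rewrite ?expr0 ?act1 // exprS actM IHk.
rewrite principal_subset -(least_idem_min mE fix_m); apply/principalP.
by exists (least_idem i * ((r * a) ^+ m * r)); rewrite exprSr !mulrA.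
Qed.

Definition orbit_label (i : 'I_n) : C := (enum_rank (unit_orbit i))%:R.

Lemma orbit_label_eq i j :
  (orbit_label i == orbit_label j) = (unit_orbit i == unit_orbit j).
Proof. by rewrite eqr_nat (inj_eq val_inj) (inj_eq enum_rank_inj). Qed.

(** The extra index [None] adds to the commuting family a diagonal matrix that separates the unit
    orbits, which forces joint eigenvectors to live on one orbit each. *)
Definition action_mx (o : option R) : 'M[C]_n :=
  if o is Some a then fun_mx C (act a) else diag_mx (\row_i orbit_label i).

Definition action_index : seq (option R) := None :: map Some (enum (units R)).

Lemma action_index_Some u : (Some u \in action_index) = (u \in units R).
Proof. by rewrite inE /= mem_map ?mem_enum // => ? ? []. Qed.

Lemma action_index_cases o : o \in action_index ->
  o = None \/ exists2 u, u \in units R & o = Some u.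
Proof. by case: o => [u|_]; [rewrite action_index_Some; right; exists u | left]. Qed.

Lemma label_comm u : u \in units R ->
  comm_mx (action_mx (Some u)) (action_mx None).
Proof.
move=> uU; apply/matrixP => i j; rewrite mul_mx_diag mul_diag_mx !mxE.
have [<-|_] := eqVneq; last by rewrite mulr0 mul0r.
by rewrite /orbit_label unit_orbit_act // mulrC.
Qed.

Lemma action_mx_comm :
  {in action_index &, forall o o', comm_mx (action_mx o) (action_mx o')}.
Proof.
move=> o o' /action_index_cases[->|[u uU ->]] /action_index_cases[->|[v vU ->]] //.
- exact/comm_mx_sym/label_comm.
- exact: label_comm.
- rewrite /comm_mx /= !mul_fun_mx; apply/matrixP => i j.
  by rewrite !mxE /= -!actM mulrC.
Qed.

Lemma action_mx_diag : {in action_index, forall o, diagonalizable (action_mx o)}.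
Proof.
move=> o /action_index_cases[->|[u uU ->]]; first exact: diagonalizable_diag.
exact/diagonalizable_fun_mx/act_inj.
Qed.

(* [B] is a basis of [C^n] by functions supported on a single unit orbit, on
   which the units act by a character; [rep k] is a point of the support of the
   [k]-th function and [mu k] its character. *)
Record adapted_basis (B : 'M[C]_n) (rep : 'I_n -> 'I_n) (mu : 'I_n -> R -> C) :
    Prop := AdaptedBasis {
  adapted_unit : B \in unitmx;
  adapted_rep : forall k, B k (rep k) != 0;
  adapted_supp : forall k j, B k j != 0 -> unit_orbit j = unit_orbit (rep k);
  adapted_mu : forall k j u, u \in units R ->
    (B *m fun_mx C (act u)) k j = mu k u * B k j;
  adapted_complete : forall i (rho : R -> C),
    {in units R &, forall u v, rho (u * v) = rho u * rho v} ->
    {in units R, forall u, act u i = i -> rho u = 1} ->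
    exists2 k, unit_orbit (rep k) = unit_orbit i &
      {in units R, forall u, mu k u = rho u}
}.

(** A joint eigenbasis of the matrices [action_mx] works; for completeness, an eigenvector with the
    prescribed orbit and character is exhibited. *)
Lemma exists_adapted_basis : exists B rep mu, adapted_basis B rep mu.
Proof.
have [B uB [mu Bmu]] := codiagonalize action_mx_comm action_mx_diag.
have nz k : exists i, B k i != 0 by apply: unitmx_row_neq0.
pose rep k := xchoose (nz k); have repP k : B k (rep k) != 0 by exact: (xchooseP (nz k)).
have label k j : B k j != 0 -> mu None 0 k = orbit_label j.
  move=> Bkj; have /matrixP/(_ k j) := Bmu None (mem_head _ _).
  rewrite mul_mx_diag mul_diag_mx [LHS]mxE [RHS]mxE [X in _ * X]mxE mulrC.
  by move/(mulIf Bkj).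
exists B, rep, (fun k u => mu (Some u) 0 k); split=> //.
- move=> k j Bkj; apply/eqP; rewrite -orbit_label_eq.
  by rewrite -(label k) // -(label k).
- move=> k j u uU; have SU : Some u \in action_index by rewrite action_index_Some.
  by have /matrixP/(_ k j) := Bmu _ SU; rewrite mul_diag_mx [X in _ = X]mxE.
move=> i rho rhoM rho_stab.
have rho1 : rho 1 = 1 by rewrite rho_stab ?units1 ?act1.
have rhoV u : u \in units R -> rho u != 0.
  move=> uU; case/unitsP: (uU) => v uv; apply/eqP => ru0.
  have vU : v \in units R by apply/unitsP; exists u; rewrite mulrC.
  by have /eqP := rho1; rewrite -uv rhoM // ru0 mul0r eq_sym oner_eq0.
(* Pushing the inverse of [rho] forward to the orbit of [i] gives eigenvalue [rho v] under [v]. Its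
   value at [i] is the order of the stabilizer, because [rho] is 1 there, so [w] is nonzero. *)
pose w : 'rV[C]_n := \row_j \sum_(u in units R | act u i == j) (rho u)^-1.
have w0 : w != 0.
  apply/rV0Pn; exists i; rewrite mxE (eq_bigr (fun=> 1)); last first.
    by move=> u /andP[uU /eqP ui]; rewrite rho_stab ?invr1.
  rewrite sumr_const pnatr_eq0 -lt0n; apply/card_gt0P; exists 1.
  by rewrite unfold_in units1 act1 eqxx.
pose nu o := if o is Some u then rho u else orbit_label i.
have [|k muk] := codiagonal_eigenvector (nu := nu) uB Bmu w0.
  move=> o /action_index_cases[->|[v vU ->]] /=.
    apply/rowP => j; rewrite mul_mx_diag !mxE mulrC.
    have [u /andP[uU /eqP <-]|none] := pickP [pred u in units R | act u i == j].
      by rewrite /orbit_label unit_orbit_act.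
    by rewrite big_pred0 ?mulr0 // => u; apply: none.
  have [v' vv'] := unitsP _ vU.
  have v'U : v' \in units R by apply/unitsP; exists v; rewrite mulrC.
  apply/rowP => j; have <- : act v (act v' j) = j by rewrite -actM vv' act1.
  move: (act v' j) => {}j; rewrite mulmx_fun_mx_inj; last exact: act_inj.
  rewrite !mxE big_distrr /= [RHS](reindex_inj (_ : injective ( *%R v))) /=.
    apply: eq_big => [u|u /andP[uU _]]; last first.
      by rewrite rhoM // invfM mulVKf ?rhoV.
    rewrite actM (inj_eq (act_inj vU)); congr (_ && _).
    apply/idP/idP => [/(unitsM vU)->//|/(unitsM v'U)].
    by rewrite mulrA [v' * v]mulrC vv' mul1r.
  by move=> x y E; rewrite -[x]mul1r -[y]mul1r -vv' [v * v']mulrC -!mulrA E.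
exists k => [|u uU].
  apply/eqP; rewrite -orbit_label_eq -(label k) //.
  by rewrite (muk None) ?mem_head.
by rewrite (muk (Some u)) ?action_index_Some.
Qed.

(** * Rows of an adapted basis and their characters *)

Section AdaptedBasis.
Variables (B : 'M[C]_n) (rep : 'I_n -> 'I_n) (mu : 'I_n -> R -> C).
Hypothesis BP : adapted_basis B rep mu.

Lemma adapted_act k i u : u \in units R -> B k i = mu k u * B k (act u i).
Proof.
by move=> uU; rewrite -(adapted_mu BP) // mulmx_fun_mx_inj //; apply: act_inj.
Qed.

Lemma adapted_mu_neq0 k u : u \in units R -> mu k u != 0.
Proof.
move=> uU; apply: contraNneq (adapted_rep BP k) => mu0.
by rewrite (adapted_act _ _ uU) mu0 mul0r.
Qed.

Lemma adapted_neq0 k i : (B k i != 0) = (unit_orbit i == unit_orbit (rep k)).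
Proof.
apply/idP/eqP => [/(adapted_supp BP)//|/esym/unit_orbit_eqP[u uU E]].
by rewrite (adapted_act _ _ uU) -E mulf_neq0 ?adapted_mu_neq0 ?(adapted_rep BP).
Qed.

(** The value [mu k u] is the ratio of the entries of row [k] at [rep k] and at its translate by
    [u], so only the translate matters. *)
Lemma adapted_mu_eq k u v : u \in units R -> v \in units R ->
  act u (rep k) = act v (rep k) -> mu k u = mu k v.
Proof.
move=> uU vU E; have nz : B k (act v (rep k)) != 0.
  by rewrite adapted_neq0 unit_orbit_act.
by apply: (mulIf nz); rewrite -adapted_act // -E -adapted_act.
Qed.

Lemma adapted_mu1 k : mu k 1 = 1.
Proof.
apply: (mulIf (adapted_rep BP k)).
by rewrite mul1r [RHS](adapted_act _ _ (units1 R)) act1.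
Qed.

Lemma adapted_muM k : {in units R &, forall u v, mu k (u * v) = mu k u * mu k v}.
Proof.
move=> u v uU vU; have uvU := unitsM uU vU.
have nz : B k (act (u * v) (rep k)) != 0 by rewrite adapted_neq0 unit_orbit_act.
apply: (mulIf nz); rewrite -adapted_act // actM -mulrA mulrCA.
by rewrite -!adapted_act.
Qed.

(* Equal data force the rows [k] and [l] of [B] to be proportional. *)
Lemma adapted_inj k l : unit_orbit (rep k) = unit_orbit (rep l) ->
  {in units R, mu k =1 mu l} -> k = l.
Proof.
move=> Okl mukl; set i := rep k.
have Bki : B k i != 0 := adapted_rep BP k.
have Bli : B l i != 0 by rewrite adapted_neq0 Okl.
have prop j : B l i * B k j = B k i * B l j.
  have [/eqP/unit_orbit_eqP[u uU ->]|nO] := boolP (unit_orbit j == unit_orbit i).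
    rewrite (adapted_act l i uU) (adapted_act k i uU) mukl //.
    by rewrite -!mulrA [B l _ * _]mulrC.
  have -> : B k j = 0 by apply/eqP; rewrite -[_ == _]negbK adapted_neq0.
  have -> : B l j = 0 by apply/eqP; rewrite -[_ == _]negbK adapted_neq0 -Okl.
  by rewrite !mulr0.
pose v : 'rV[C]_n := B l i *: delta_mx 0 k - B k i *: delta_mx 0 l.
have vB : v *m B = 0.
  apply/rowP => j; rewrite mulmxBl -!scalemxAl -!rowE !mxE.
  by rewrite prop subrr.
have v0 : v = 0 by rewrite -(mulmxK (adapted_unit BP) v) vB mul0mx.
apply/eqP; apply: contraNT Bli => kl.
have /rowP/(_ k) := v0; rewrite !mxE !eqxx /= (negPf kl) mulr0 subr0 mulr1.
by move->.
Qed.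

(** [B] intertwines the diagonal matrices of orbit labels of columns and of rows; its inverse then
    does so in the other direction. *)
Lemma adapted_inv_supp j l :
  invmx B j l != 0 -> unit_orbit j = unit_orbit (rep l).
Proof.
pose L : 'rV[C]_n := \row_i orbit_label i.
pose L' : 'rV[C]_n := \row_k orbit_label (rep k).
have uB := adapted_unit BP.
have BL : B *m diag_mx L = diag_mx L' *m B.
  apply/matrixP => k i; rewrite mul_mx_diag mul_diag_mx !mxE mulrC.
  have [->|] := eqVneq (B k i) 0; first by rewrite !mulr0.
  by rewrite adapted_neq0 -orbit_label_eq => /eqP->.
have LB : diag_mx L *m invmx B = invmx B *m diag_mx L'.
  by rewrite -[LHS](mulKmx uB) [B *m _]mulmxA BL -[diag_mx _ *m _ *m _]mulmxA mulmxV // mulmx1.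
move=> nz; apply/eqP; rewrite -orbit_label_eq; apply/eqP.
have /matrixP/(_ j l) := LB.
by rewrite mul_mx_diag mul_diag_mx !mxE mulrC; apply: mulfI.
Qed.

(** * Triangularity of the walk in the adapted basis *)

Section Walk.
Variables (x y : 'I_n -> C) (q : R -> C).
Hypothesis x_orbit : forall u i, u \in units R -> x (act u i) = x i.
Hypothesis y_orbit : forall u i, u \in units R -> y (act u i) = y i.

(** A common form for both walks: the coin toss has a constant [y] and puts the heads term in [x];
    the affine walk has [x = 0] and puts the transform of [P] in [y]. *)
Definition walk_mx : 'M[C]_n :=
  \matrix_(i, j) (x i *+ (i == j) + y i * \sum_(a | act a i == j) q a).

Definition walk_eigenvalue k : C :=
  let e := least_idem (rep k) in
  x (rep k) + y (rep k) * \sum_(a | principal e \subset principal a)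
                             q a * mu k (extend_unit e (a * e)).

Lemma adapted_supp_const (z : 'I_n -> C) k i :
    (forall u i, u \in units R -> z (act u i) = z i) ->
  B k i * z i = z (rep k) * B k i.
Proof.
move=> zU; have [->|] := eqVneq (B k i) 0; first by rewrite mulr0 mul0r.
by rewrite adapted_neq0 mulrC => /eqP/unit_orbit_eqP[u uU ->]; rewrite zU.
Qed.

Lemma adapted_mul_walk k j :
  (B *m walk_mx) k j =
  x (rep k) * B k j + y (rep k) * \sum_a q a * (B *m fun_mx C (act a)) k j.
Proof.
rewrite mxE; under eq_bigr do rewrite mxE mulrDr mulrA.
rewrite big_split /=; congr (_ + _).
  rewrite (bigD1 j) //= eqxx adapted_supp_const // big1 ?addr0 // => i /negPf ij.
  by rewrite ij mulr0.
under eq_bigr do rewrite adapted_supp_const // -mulrA.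
rewrite -big_distrr /=; congr (_ * _).
under [RHS]eq_bigr do rewrite mxE big_distrr.
rewrite exchange_big /=; apply: eq_bigr => i _; rewrite big_distrr big_mkcond /=.
apply: eq_bigr => a _; rewrite mxE; case: eqP => _; last by rewrite !mulr0.
by rewrite mulr1 mulrC.
Qed.

(** The least idempotent is constant on the support of row [k], so [a] acts there as one and the
    same unit of [R]. *)
Lemma adapted_mul_act k j a :
    let e := least_idem (rep k) in
    principal e \subset principal a ->
  (B *m fun_mx C (act a)) k j = mu k (extend_unit e (a * e)) * B k j.
Proof.
move=> e ea; have eE : e \in idempotents R by apply: least_idem_idem.
have uU : extend_unit e (a * e) \in units R.
  by rewrite extend_unit_units // units_at_principal.
rewrite -(adapted_mu BP) // !mxE; apply: eq_bigr => i _; rewrite !mxE.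
have [->|] := eqVneq (B k i) 0; first by rewrite !mul0r.
rewrite adapted_neq0 => /eqP Oi; rewrite -(act_extend_unit i).
by rewrite (least_idem_orbit Oi).
Qed.

(** The [a] with [Ra] containing [Re] account for the eigenvalue; every other [a] sends the support
    of row [k] to smaller heights. *)
Lemma walk_mx_residue k j :
  (B *m walk_mx) k j != walk_eigenvalue k * B k j -> (height j < height (rep k))%N.
Proof.
apply: contraR => hj; rewrite adapted_mul_walk /walk_eigenvalue mulrDl.
apply/eqP; congr (_ + _); rewrite -mulrA; congr (_ * _).
rewrite big_distrl [RHS]big_mkcond; apply: eq_bigr => a _.
have [ea|nea] := ifPn; first by rewrite adapted_mul_act ?mulrA.
rewrite mulmx_fun_mxE big1 ?mulr0 // => i /eqP aij.
apply/eqP; rewrite -[_ == _]negbK adapted_neq0; apply: contra hj => /eqP Oi.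
rewrite -aij -(height_orbit Oi) height_act_lt //.
by rewrite (least_idem_orbit Oi).
Qed.

(** After conjugation by [B] the residue is multiplied by [invmx B], which respects unit orbits and
    hence heights. The result is triangular for the height, with the eigenvalues on the diagonal. *)
Lemma char_poly_walk_mx :
  char_poly walk_mx = \prod_k ('X - (walk_eigenvalue k)%:P).
Proof.
have uB := adapted_unit BP.
pose D := B *m walk_mx *m invmx B; pose lam := \row_k walk_eigenvalue k.
rewrite (char_poly_mul_eq (D := D) uB); last by rewrite mulmxKV.
have DE : D = diag_mx lam + (B *m walk_mx - diag_mx lam *m B) *m invmx B.
  by rewrite mulmxBl mulmxK // addrC subrK.
have Dh k l : D k l != lam 0 k *+ (k == l) -> (height (rep l) < height (rep k))%N.
  rewrite DE mxE [diag_mx _ _ _]mxE -subr_eq0 [X in X - _]addrC addrK mxE.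
  apply: contraR => h; apply/eqP; apply: big1 => j _; apply/eqP; rewrite mulf_eq0.
  rewrite -[_ || _]negbK negb_or; apply: contra h => /andP[rj ij].
  rewrite -(height_orbit (adapted_inv_supp ij)); apply: walk_mx_residue.
  by move: rj; rewrite mul_diag_mx !mxE subr_eq0.
rewrite (char_poly_height_trig (h := height \o rep)) => [|k l Dkl kl].
  apply: eq_bigr => k _; congr ('X - _%:P); apply/eqP.
  by apply: contraT => h; have := @Dh k k; rewrite eqxx mulr1n [lam 0 k]mxE ltnn => /(_ h).
by apply: Dh; rewrite (negPf kl).
Qed.

End Walk.
End AdaptedBasis.
End MonoidAction.

(** * The characters of [V] as a basis of the functions on [V] *)

Section CharacterBasis.
Variables (K : realType) (R : finComNzRingType) (V : finLmodType R).
Implicit Types psi : {ffun V -> K[i]}.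

Lemma character_neq0 psi v : is_character psi -> psi v != 0.
Proof.
case=> psi0 psiD; apply/eqP => pv; have /eqP := psi0.
by rewrite -(subrr v) psiD pv mul0r eq_sym oner_eq0.
Qed.

Lemma char_scale_character a psi :
  is_character psi -> is_character (char_scale a psi).
Proof.
by case=> psi0 psiD; split=> [|v w]; rewrite !ffunE ?scaler0 // scalerDr psiD.
Qed.

Lemma char_scale1 psi : char_scale 1 psi = psi.
Proof. by apply/ffunP => v; rewrite ffunE scale1r. Qed.

Lemma char_scaleM a b psi :
  char_scale (a * b) psi = char_scale a (char_scale b psi).
Proof. by apply/ffunP => v; rewrite !ffunE scalerA mulrC. Qed.

Definition translate (v : V) (i : 'I_#|V|) : 'I_#|V| :=
  enum_rank (enum_val i + v).

Lemma translate_inj v : injective (translate v).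
Proof. by move=> i j /enum_rank_inj/addIr/enum_val_inj. Qed.

Definition char_table (chi : 'I_#|V| -> {ffun V -> K[i]}) : 'M[K[i]]_#|V| :=
  \matrix_(k, i) chi k (enum_val i).

(** Joint eigenvectors of the translations, normalized to 1 at 0, are characters. Conversely each
    character is such an eigenvector, so its eigenvalues occur in the basis and determine it. *)
Lemma exists_character_basis : exists chi : 'I_#|V| -> {ffun V -> K[i]},
  [/\ forall k, is_character (chi k),
      forall psi, is_character psi -> exists k, chi k = psi &
      char_table chi \in unitmx].
Proof.
have [||B uB [mu Bmu]] :=
    codiagonalize (s := enum V) (A := fun v => fun_mx K[i] (translate v)).
- move=> v w _ _; rewrite /comm_mx !mul_fun_mx; apply/matrixP => i j.
  by rewrite !mxE /= /translate !enum_rankK addrAC.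
- by move=> v _; apply/diagonalizable_fun_mx/translate_inj.
pose f k x := B k (enum_rank x); pose m k v := mu v 0 k.
have fE k v x : f k x = m k v * f k (x + v).
  have /matrixP/(_ k (translate v (enum_rank x))) := Bmu v (mem_enum _ v).
  rewrite mulmx_fun_mx_inj; last exact: translate_inj.
  by rewrite mul_diag_mx [RHS]mxE /translate enum_rankK.
have f0 k : f k 0 != 0.
  have [i Bki] := unitmx_row_neq0 k uB; apply: contraNneq Bki => fk0.
  rewrite -(enum_valK i) -/(f k _) (fE _ (- enum_val i)).
  by rewrite subrr fk0 mulr0.
pose chi k : {ffun V -> K[i]} := [ffun x => (f k 0)^-1 * f k x].
have mchi k v : m k v * chi k v = 1.
  by have := fE k v 0; rewrite add0r => E; rewrite ffunE mulrCA -E mulVf.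
have mN0 k v : m k v != 0.
  by apply: contraTneq (oner_neq0 K[i]) => m0; rewrite -(mchi k v) m0 mul0r eqxx.
have chi_char k : is_character (chi k).
  split=> [|v w]; first by rewrite ffunE mulVf.
  by apply: (mulfI (mN0 k w)); rewrite mulrCA mchi mulr1 !ffunE mulrCA -fE.
exists chi; split=> //.
- move=> psi psiC; pose w : 'rV[K[i]]_#|V| := \row_i psi (enum_val i).
  have [psi0 psiD] := psiC.
  have w0 : w != 0.
    by apply/rV0Pn; exists (enum_rank 0); rewrite mxE character_neq0.
  (* Pushforward moves the value at [x] to [x + v], whence the sign in the eigenvalue. *)
  have [v _|k muk] := codiagonal_eigenvector (nu := fun v => psi (- v)) uB Bmu w0.
    have [s sK Ks] : bijective (translate v) by apply/injF_bij/translate_inj.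
    apply/rowP => j; rewrite -(Ks j) mulmx_fun_mx_inj; last exact: translate_inj.
    by rewrite !mxE /translate enum_rankK -psiD addrC addrK.
  exists k; apply/ffunP => v; apply: (mulfI (mN0 k v)); rewrite mchi.
  by rewrite /m muk ?mem_enum // -psiD addNr psi0.
have -> : char_table chi = diag_mx (\row_k (f k 0)^-1) *m B.
  by apply/matrixP => k i; rewrite mul_diag_mx !mxE ffunE /f enum_valK.
rewrite unitmx_mul uB andbT unitmxE det_diag unitfE prodf_seq_neq0.
by apply/allP => k _; rewrite mxE invr_eq0 f0.
Qed.

End CharacterBasis.

(** * The walks applied to a character *)

Section WalkOnCharacters.
Variables (K : realType) (R : finComNzRingType) (V : finLmodType R).
Variables (P : V -> K) (Q : R -> K).
Implicit Types psi : {ffun V -> K[i]}.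

Lemma sum_pushforward (T S : finType) (F : T -> S) (w : T -> K) (g : S -> K[i]) :
  \sum_y g y * (\sum_(t | F t == y) w t)%:C = \sum_t (w t)%:C * g (F t).
Proof.
rewrite [RHS](partition_big F predT) //=; apply: eq_bigr => y _.
rewrite rmorph_sum big_distrr /=; apply: eq_bigr => t /eqP->.
by rewrite mulrC.
Qed.

Lemma coin_toss_walk_character alpha psi x : is_character psi ->
  \sum_y psi y * (coin_toss_walk P Q alpha x y)%:C =
  alpha%:C * hatP P psi * psi x
  + (1 - alpha)%:C * \sum_a (Q a)%:C * char_scale a psi x.
Proof.
case=> _ psiD; under eq_bigr do rewrite rmorphD !rmorphM /= mulrDr !(mulrCA (psi _)).
rewrite big_split -!big_distrr !sum_pushforward /= -mulrA; congr (_ * _ + _ * _).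
  by rewrite big_distrl; apply: eq_bigr => b _; rewrite psiD /= mulrA mulrAC.
by apply: eq_bigr => a _; rewrite ffunE.
Qed.

(** Since [psi] turns [a *: x + b] into a product, independence of [a] and [b] factors the
    expectation. *)
Lemma affine_walk_character psi x : is_character psi ->
  \sum_y psi y * (affine_walk P Q x y)%:C =
  hatP P psi * \sum_a (Q a)%:C * char_scale a psi x.
Proof.
case=> _ psiD; rewrite /affine_walk.
under eq_bigr do rewrite rmorph_sum big_distrr /=.
rewrite exchange_big big_distrr /=; apply: eq_bigr => a _.
rewrite sum_pushforward big_distrl /=; apply: eq_bigr => b _.
by rewrite rmorphM psiD ffunE /=; ring.
Qed.

(** Substitute [u *: b] for [b]. Thus the transform of [P] depends only on the orbit of the
    character. *)
Lemma hatP_units u psi : constant_on_associates P -> u \in units R ->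
  hatP P (char_scale u psi) = hatP P psi.
Proof.
move=> PA uU; have [v uv] := unitsP _ uU.
rewrite /hatP [RHS](reindex_inj (_ : injective ( *:%R u))) /=.
  by apply: eq_bigr => b _; rewrite PA // ffunE.
by move=> x y E; rewrite -[x]scale1r -[y]scale1r -uv mulrC -!scalerA E.
Qed.

End WalkOnCharacters.

(** * The monoid action on an enumeration of the characters *)

Section IndexedCharacters.
Variables (K : realType) (R : finComNzRingType) (V : finLmodType R).
Variable chi : 'I_#|V| -> {ffun V -> K[i]}.
Hypothesis chi_char : forall k, is_character (chi k).
Hypothesis chi_onto : forall psi, is_character psi -> exists k, chi k = psi.
Hypothesis chi_unit : char_table chi \in unitmx.

Lemma chi_inj : injective chi.
Proof.
move=> k l E; apply/eqP; apply: contraTT chi_unit => kl.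
rewrite unitmxE (determinant_alternate kl) ?unitr0 // => i.
by rewrite !mxE E.
Qed.

(** The default [k] is never reached, because [chi] enumerates all characters. *)
Definition char_act (a : R) (k : 'I_#|V|) : 'I_#|V| :=
  odflt k [pick l | chi l == char_scale a (chi k)].

Lemma chi_act a k : chi (char_act a k) = char_scale a (chi k).
Proof.
rewrite /char_act; case: pickP => [l /eqP //|none].
have [l E] := chi_onto (char_scale_character a (chi_char k)).
by have := none l; rewrite E eqxx.
Qed.

Lemma char_act1 k : char_act 1 k = k.
Proof. by apply: chi_inj; rewrite chi_act char_scale1. Qed.

Lemma char_actM a b k : char_act (a * b) k = char_act a (char_act b k).
Proof. by apply: chi_inj; rewrite !chi_act char_scaleM. Qed.

(** An idempotent acts as a projection, so its image is its set of fixed points. *)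
Lemma in_scaled_dualP f k : f \in idempotents R ->
  in_scaled_dual f (chi k) <-> char_act f k = k.
Proof.
move/idempotentsP=> ff; split=> [[psi psiC E]|E].
  by apply: chi_inj; rewrite chi_act E -char_scaleM ff.
by exists (chi k) => //; rewrite -chi_act E.
Qed.

Local Notation least_idem := (least_idem char_act).
Local Notation unit_orbit := (unit_orbit char_act).

(** The least idempotent generates an ideal inside [Re]; minimality makes the two ideals equal, and
    idempotents with the same ideal coincide. So each character lies in exactly one stratum. *)
Lemma in_stratumP e k : e \in idempotents R ->
  in_stratum e (chi k) <-> e = least_idem k.
Proof.
have lE := least_idem_idem char_act k.
have lk := act_least_idem char_act1 char_actM k.
move=> eE; split=> [[/in_scaled_dualP ek min]|->].
  have le := least_idem_min eE (ek eE).
  have sub : principal (least_idem k) \subset principal e.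
    by rewrite principal_subset principal_idem // le.
  have : ~~ (principal (least_idem k) \proper principal e).
    by apply/negP => /(min _ lE); apply; apply/in_scaled_dualP.
  rewrite properE sub negbK principal_subset principal_idem // => /eqP <-.
  by rewrite mulrC le.
split; first exact/in_scaled_dualP.
move=> f fE /andP[_ /negP nsub] /(in_scaled_dualP _ fE) fk; apply: nsub.
by rewrite principal_subset principal_idem // least_idem_min.
Qed.

Lemma char_orbitP k psi :
  reflect (exists2 u, u \in units R & psi = char_scale u (chi k))
          (psi \in char_orbit (chi k)).
Proof. by apply: (iffP (imfsetP _ _ _ _)) => -[u uU ->]; exists u. Qed.

Lemma char_orbit_eq k l :
  char_orbit (chi k) = char_orbit (chi l) <-> unit_orbit k = unit_orbit l.
Proof.
split=> [E|/(unit_orbit_eqP char_act1)[u uU ->]].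
  have : chi k \in char_orbit (chi l).
    by rewrite -E; apply/char_orbitP; exists 1; rewrite ?units1 ?char_scale1.
  case/char_orbitP=> u uU; rewrite -chi_act => /chi_inj->.
  exact: unit_orbit_act char_actM _ _ uU.
apply/fsetP => psi.
have E := unit_orbit_act char_actM l uU.
apply/char_orbitP/char_orbitP => -[v vU ->].
  by exists (v * u); rewrite ?unitsM // chi_act char_scaleM.
have [w wU E'] : exists2 w, w \in units R & char_act v l = char_act w (char_act u l).
  by apply/imsetP; rewrite -/(unit_orbit _) E; apply/imsetP; exists v.
by exists w => //; rewrite -!chi_act E'.
Qed.

(** The transition matrix acts on functions as columns; after transposition the characters become
    the rows of [char_table], which intertwines it with [walk_mx]. *)
Lemma char_poly_transition (p : V -> V -> K) (x y : 'I_#|V| -> K[i])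
    (q : R -> K[i]) :
    (forall k v, \sum_w chi k w * (p v w)%:C =
       x k * chi k v + y k * \sum_a q a * char_scale a (chi k) v) ->
  char_poly (transition_mx p) = char_poly (walk_mx char_act x y q).
Proof.
move=> chip; rewrite -char_poly_trmx; apply: (char_poly_mul_eq chi_unit).
apply/matrixP => k i; rewrite !mxE.
transitivity (\sum_w chi k w * (p (enum_val i) w)%:C).
  rewrite [RHS](reindex (@enum_val V predT)) /=; last first.
    by apply: onW_bij; apply: enum_val_bij.
  by apply: eq_bigr => j _; rewrite !mxE.
rewrite chip; under [RHS]eq_bigr do rewrite !mxE mulrDl -mulrA.
rewrite big_split /=; congr (_ + _).
  rewrite (bigD1 k) //= eqxx mulr1n big1 ?addr0 // => l /negPf lk.
  by rewrite eq_sym lk mulr0n mul0r.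
rewrite -big_distrr /=; congr (_ * _).
rewrite [LHS](partition_big (char_act^~ k) predT) //=; apply: eq_bigr => l _.
by rewrite big_distrl; apply: eq_bigr => a /eqP <-; rewrite chi_act.
Qed.

(** * Admissible triples and rows of the adapted basis *)

Section Triples.
Variables (B : 'M[K[i]]_#|V|) (rep : 'I_#|V| -> 'I_#|V|).
Variable mu : 'I_#|V| -> R -> K[i].
Hypothesis BP : adapted_basis char_act B rep mu.

(** The character [mu k] of [U(R)] is restricted to [U(Re)] along the section [extend_unit e]. *)
Definition triple_at k : triple K V :=
  let e := least_idem (rep k) in
  (e, char_orbit (chi (rep k)),
   [ffun u => if u \in units_at e then mu k (extend_unit e u) else 0]).

Lemma char_triple_at k u : let e := least_idem (rep k) in
  u \in units_at e -> char_of (triple_at k) u = mu k (extend_unit e u).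
Proof. by move=> e ue; rewrite ffunE ue. Qed.

(** The unit [u] and the extension of [u * e] agree on [rep k], so the triple determines [mu k] on
    all units. *)
Lemma adapted_mu_char k u : u \in units R ->
  mu k u = char_of (triple_at k) (u * least_idem (rep k)).
Proof.
have eE := least_idem_idem char_act (rep k); move=> uU.
have ueU := units_at_mulr eE uU.
rewrite char_triple_at //; apply: (adapted_mu_eq char_act1 char_actM BP) => //.
  exact: extend_unit_units.
by rewrite (act_extend_unit char_act1 char_actM).
Qed.

Lemma admissible_triple_at k : admissible (triple_at k).
Proof.
have eE := least_idem_idem char_act (rep k).
split=> //; exists (chi (rep k)); set e := idem_of _.
have rhoE u : u \in units_at e -> char_of (triple_at k) u = mu k (extend_unit e u).
  exact: char_triple_at.
split=> //.
- exact/in_stratumP.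
- split=> [|u v ue ve|u nu]; last by rewrite ffunE (negPf nu).
    rewrite rhoE ?units_at_id // /extend_unit addrC subrK.
    exact: adapted_mu1 char_act1 char_actM _ _ _ BP _.
  have [[ue1 [u' uu']] [ve1 [v' vv']]] := (units_atP _ eE ue, units_atP _ eE ve).
  have uve : u * v \in units_at e.
    apply/(units_atP _ eE); rewrite -mulrA ve1; split=> //; exists (u' * v').
    by rewrite mulrACA uu' vv' (idempotentsP _ eE).
  rewrite !rhoE // extend_unitM //.
  by rewrite (adapted_muM char_act1 char_actM BP) ?extend_unit_units.
apply/subsetP => u; rewrite inE => /andP[ue /eqP uchi]; rewrite inE ue rhoE //=.
have [ue1 _] := units_atP _ eE ue.
(* A stabilizing unit moves [rep k] no more than 1 does, so its value is that of 1. *)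
rewrite (adapted_mu_eq char_act1 char_actM BP (v := 1)) ?units1 //.
- by rewrite (adapted_mu1 char_act1 char_actM BP).
- exact: extend_unit_units.
rewrite char_act1 -{1}ue1 (act_extend_unit char_act1 char_actM).
by apply: chi_inj; rewrite chi_act.
Qed.

Lemma triple_at_inj : injective triple_at.
Proof.
move=> k l E; have Okl : unit_orbit (rep k) = unit_orbit (rep l).
  by apply/char_orbit_eq; have := congr1 (@orbit_of _ _ _) E.
apply: (adapted_inj char_act1 char_actM BP Okl) => u uU.
rewrite !adapted_mu_char // E.
by rewrite (least_idem_orbit char_act1 char_actM Okl).
Qed.

(** Pulled back along multiplication by [e], [rho] is a character of [U(R)] trivial on the
    stabilizer of the orbit representative; completeness of the adapted basis provides the row. *)
Lemma admissible_triple_ex t : admissible t -> exists k, t = triple_at k.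
Proof.
case: t => [[e O] rho] [/= eE [psi [psiS EO [rho1 rhoM rho0] /subsetP rhoK]]].
rewrite /idem_of /orbit_of /char_of /= in eE psiS EO rho1 rhoM rho0 rhoK *.
rewrite {O}EO.
have [i Epsi] : exists i, chi i = psi.
  by case: psiS => [[phi phiC ->] _]; apply/chi_onto/char_scale_character.
rewrite -{psi}Epsi in psiS rhoK *.
have Ee : e = least_idem i by apply/in_stratumP.
have [u v uU vU|u uU ui|k Oki muk] :=
    adapted_complete BP (i := i) (rho := fun u => rho (u * e)).
- by rewrite -rhoM ?units_at_mulr // mulrACA (idempotentsP _ eE).
- have : u * e \in unit_ker e rho.
    apply: rhoK; rewrite inE units_at_mulr //= -chi_act Ee.
    by rewrite (act_mul_least char_act1 char_actM) ui.
  by rewrite inE => /andP[_ /eqP].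
exists k; have Ek : least_idem (rep k) = e.
  by rewrite (least_idem_orbit char_act1 char_actM Oki).
rewrite /triple_at Ek; congr (_, _, _); first exact/char_orbit_eq.
apply/ffunP => u; rewrite ffunE; case: ifPn => [ue|/rho0//].
have [ue1 _] := units_atP _ eE ue.
by rewrite muk ?extend_unit_units // extend_unit_mul.
Qed.

Lemma walk_eigenvalue_triple x y (Q : R -> K) k :
  walk_eigenvalue char_act rep mu x y (fun a => (Q a)%:C) k =
  x (rep k) + y (rep k) * hatQ Q (idem_of (triple_at k)) (char_of (triple_at k)).
Proof.
rewrite /walk_eigenvalue; congr (_ + _ * _); apply: eq_bigr => a ea.
by rewrite char_triple_at // units_at_principal // least_idem_idem.
Qed.

Lemma hatP_triple (P : V -> K) psi k : constant_on_associates P ->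
  psi \in orbit_of (triple_at k) -> hatP P psi = hatP P (chi (rep k)).
Proof. by move=> PA /char_orbitP[u uU ->]; rewrite hatP_units. Qed.

Lemma transition_eigenvalues (p : V -> V -> K) (x y : 'I_#|V| -> K[i]) (Q : R -> K)
    (lam : triple K V -> K[i]) :
    (forall u i, u \in units R -> x (char_act u i) = x i) ->
    (forall u i, u \in units R -> y (char_act u i) = y i) ->
    (forall k v, \sum_w chi k w * (p v w)%:C =
       x k * chi k v + y k * \sum_a (Q a)%:C * char_scale a (chi k) v) ->
    (forall k, lam (triple_at k) = x (rep k) + y (rep k) *
       hatQ Q (idem_of (triple_at k)) (char_of (triple_at k))) ->
  eigenvalues_are (transition_mx p)
    [seq lam t | t <- [seq triple_at k | k <- enum 'I_#|V|]].
Proof.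
move=> xU yU chip lamE; rewrite /eigenvalues_are (char_poly_transition chip).
rewrite (char_poly_walk_mx char_act1 char_actM BP) // 2![in RHS]big_map big_enum.
by apply: eq_bigr => k _; rewrite lamE walk_eigenvalue_triple.
Qed.

End Triples.
End IndexedCharacters.

(** * The spectra of the two walks *)

Theorem theorem4p1 (K : realType) (R : finComNzRingType) (V : finLmodType R)
    (P : V -> K) (Q : R -> K) (alpha : K)
    (P_prob : is_probability P) (Q_prob : is_probability Q)
    (P_assoc : constant_on_associates P) (alpha01 : 0 <= alpha <= 1) :
  exists s : seq (triple K V),
    [/\ uniq s, forall t, t \in s <-> admissible t &
      forall chi : triple K V -> {ffun V -> K[i]},
        (forall t, t \in s -> chi t \in orbit_of t) ->
        eigenvalues_are (transition_mx (coin_toss_walk P Q alpha))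
          [seq alpha%:C * hatP P (chi t)
               + (1 - alpha)%:C * hatQ Q (idem_of t) (char_of t) | t <- s] /\
        eigenvalues_are (transition_mx (affine_walk P Q))
          [seq hatP P (chi t) * hatQ Q (idem_of t) (char_of t) | t <- s]].
Proof.
have [chi [chi_char chi_onto chi_unit]] := exists_character_basis K V.
have act1 := char_act1 chi_char chi_onto chi_unit.
have actM := char_actM chi_char chi_onto chi_unit.
have [B [rep [mu BP]]] := exists_adapted_basis K[i] act1 actM.
have tri_inj := triple_at_inj chi_char chi_onto chi_unit BP.
exists [seq triple_at chi rep mu k | k <- enum 'I_#|V|]; split=> [|t|phi phiO].
- by rewrite map_inj_uniq // enum_uniq.
- split=> [/mapP[k _ ->]|].
    exact: admissible_triple_at chi_char chi_onto chi_unit _ _ _ BP k.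
  case/(admissible_triple_ex chi_char chi_onto chi_unit BP)=> k ->.
  by rewrite map_f // mem_enum.
(* Any choice [phi] of orbit representatives gives the same transform of [P]. *)
have phiP k : hatP P (phi (triple_at chi rep mu k)) = hatP P (chi (rep k)).
  by apply: hatP_triple P_assoc (phiO _ _); rewrite map_f // mem_enum.
have hatP_act u k : u \in units R -> hatP P (chi (char_act chi u k)) = hatP P (chi k).
  by move=> uU; rewrite chi_act // hatP_units.
split.
  pose lam t := alpha%:C * hatP P (phi t)
    + (1 - alpha)%:C * hatQ Q (idem_of t) (char_of t).
  apply: (transition_eigenvalues chi_char chi_onto chi_unit BP (lam := lam)
    (x := fun k => alpha%:C * hatP P (chi k)) (y := fun=> (1 - alpha)%:C)) => //.
  - by move=> u k uU; rewrite hatP_act.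
  - by move=> k v; apply: coin_toss_walk_character.
  - by move=> k; rewrite /lam phiP.
pose lam t := hatP P (phi t) * hatQ Q (idem_of t) (char_of t).
apply: (transition_eigenvalues chi_char chi_onto chi_unit BP (lam := lam)
  (x := fun=> 0) (y := fun k => hatP P (chi k))) => //.
- by move=> k v; rewrite mul0r add0r; apply: affine_walk_character.
- by move=> k; rewrite /lam phiP add0r.
Qed.
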